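(* For all integers $d,a,w,p\ge 1$, there exists an integer $n$ such that for every graph $G$: if every $d$-edge-connected subset of $V(G)$ is $(a,w,p)$-linear in $G$, then $G$ does not contain the complete graph $K_n$ as a strong immersion.
   Context: Graphs are finite and may have parallel edges and loops (each loop contributes $2$ to the degree of its vertex); $K_n$ is the simple complete graph on $n$ vertices. Strong immersion. An immersion of $H$ in $G$ is a function $\theta$ on the vertices and edges of $H$ such that: (i) $\theta(v)\in V(G)$ for each $v\in V(H)$, and $\theta$ restricted to $V(H)$ is injective; (ii) $\theta(e)$ is a connected subgraph of $G$ for each $e\in E(H)$, and $\theta(e),\theta(f)$ are edge-disjoint for distinct $e,f\in E(H)$; (iii) if $e\in E(H)$ is incident with $v\in V(H)$, then $\theta(v)$ is a vertex of $\theta(e)$, and if $e$ is a loop, then $\theta(e)$ contains a cycle passing through $\theta(v)$ (a loop or a pair of parallel edges counts as a cycle). The immersion is strong if moreover, whenever $e\in E(H)$ is not incident with $v\in V(H)$, $\theta(e)$ does not contain $\theta(v)$. ''$G$ contains $H$ as a strong immersion'' means such a strong $\theta$ exists. Edge-connected sets. For an integer $k\ge 1$, a set $W\subseteq V(G)$ is $k$-edge-connected if no two vertices of $W$ are separated by an edge-cut of size less than $k$ in $G$. Path-like decompositions. A near-partition of a set $Z$ is a family of pairwise disjoint, possibly empty, subsets of $Z$ with union $Z$. For $X\subseteq V(G)$, a path-like decomposition $\mathcal{P}$ of $G$ with respect to $X$ is an ordering $x_1,\dots,x_t$ of the vertices of $X$ together with a near-partition $B_0,\dots,B_t$ of $V(G)\setminus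 X$; the sets $B_i$ are its bags. The $x_i$-cut is the set of edges of $G$ with one endpoint in $\{x_1,\dots,x_{i-1}\}\cup B_0\cup\dots\cup B_{i-1}$ and the other endpoint in $\{x_{i+1},\dots,x_t\}\cup B_i\cup\dots\cup B_t$. The width of $\mathcal{P}$ is the maximum size of an $x$-cut over $x\in X$ (it is $0$ if $X=\emptyset$). For a set $Z$ of vertices, $b_{\mathcal{P}}(Z)$ is the number of bags of $\mathcal{P}$ that intersect $Z$; for an integer $p\ge 0$, $Z$ is $p$-bounded in $\mathcal{P}$ if $|X\cap Z|+b_{\mathcal{P}}(Z)\le p$. Linear sets. For positive integers $a,w,p$, a set $W\subseteq V(G)$ is $(a,w,p)$-linear if there exists $A\subseteq W$ with $|A|\le a$ such that $G-A$ has a path-like decomposition $\mathcal{P}$ with respect to $W\setminus A$ of width less than $w$ and the neighborhood (in $G$) of every vertex of $A$ is $p$-bounded in $\mathcal{P}$. *)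

(* Defs.v *)
From HB Require Import structures.
From mathcomp Require Import all_boot.

Set Implicit Arguments.
Unset Strict Implicit.
Unset Printing Implicit Defensive.

(* Finite undirected graphs with parallel edges and loops. The order of the two
   ends of an edge carries no meaning: every notion below is symmetric in it. *)
Record mgraph := MGraph {
  vert : finType;
  edge : finType;
  src : edge -> vert;
  tgt : edge -> vert
}.

Arguments src {m} _.
Arguments tgt {m} _.

Definition incident (G : mgraph) (e : edge G) (v : vert G) : bool :=
  (v == src e) || (v == tgt e).

Definition is_loop (G : mgraph) (e : edge G) : bool := src e == tgt e.

Definition joins (G : mgraph) (e : edge G) (u v : vert G) : bool :=
  ((src e == u) && (tgt e == v)) || ((src e == v) && (tgt e == u)).

Definition nbhd (G : mgraph) (v : vert G) : {set vert G} :=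
  [set u | (u != v) && [exists e, joins e u v]].

Definition edges_between (G : mgraph) (L R : {set vert G}) : {set edge G} :=
  [set e | ((src e \in L) && (tgt e \in R)) || ((src e \in R) && (tgt e \in L))].

Definition complete_graph (n : nat) : mgraph :=
  @MGraph 'I_n {ij : 'I_n * 'I_n | ij.1 < ij.2}
    (fun e => (val e).1) (fun e => (val e).2).

Section Deletion.

Variables (G : mgraph) (A : {set vert G}).

Local Notation del_vert := {v : vert G | v \notin A}.
Local Notation del_edge := {e : edge G | (src e \notin A) && (tgt e \notin A)}.

Definition del_src (e : del_edge) : del_vert :=
  exist _ (src (val e)) (proj1 (andP (valP e))).
Definition del_tgt (e : del_edge) : del_vert :=
  exist _ (tgt (val e)) (proj2 (andP (valP e))).

Definition delete : mgraph := @MGraph del_vert del_edge del_src del_tgt.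

(* The trace on the vertices of G - A of a set Z of vertices of G, i.e. Z \ A. *)
Definition trace (Z : {set vert G}) : {set vert delete} :=
  [set v : vert delete | val v \in Z].

End Deletion.

Record subgraph (G : mgraph) := Subgraph {
  sub_vert : {set vert G};
  sub_edge : {set edge G};
  sub_ends : forall e, e \in sub_edge -> (src e \in sub_vert) && (tgt e \in sub_vert)
}.

Definition connected_subgraph (G : mgraph) (S : subgraph G) : Prop :=
  sub_vert S != set0 /\
  {in sub_vert S &, forall u v,
     connect [rel x y | [exists e in sub_edge S, joins e x y]] u v}.

(* The cycle has k.+1 distinct vertices u i and k.+1 distinct edges f i, where
   f i joins u i to its cyclic successor: k = 0 gives a loop, k = 1 a pair of
   parallel edges. *)
Definition has_cycle_through (G : mgraph) (S : subgraph G) (v : vert G) : Prop :=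
  exists (k : nat) (u : 'I_k.+1 -> vert G) (f : 'I_k.+1 -> edge G),
    [/\ injective u, injective f, u ord0 = v &
        forall i, f i \in sub_edge S /\ joins (f i) (u i) (u (ordS i))].

Record is_immersion (H G : mgraph)
    (thV : vert H -> vert G) (thE : edge H -> subgraph G) : Prop := IsImmersion {
  immersion_inj : injective thV;
  immersion_connected : forall e, connected_subgraph (thE e);
  immersion_disjoint : forall e f, e != f ->
    [disjoint sub_edge (thE e) & sub_edge (thE f)];
  immersion_incident : forall e v, incident e v -> thV v \in sub_vert (thE e);
  immersion_loop : forall e v, incident e v -> is_loop e ->
    has_cycle_through (thE e) (thV v)
}.

Definition is_strong_immersion (H G : mgraph)
    (thV : vert H -> vert G) (thE : edge H -> subgraph G) : Prop :=
  is_immersion thV thE /\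
  forall e v, ~~ incident e v -> thV v \notin sub_vert (thE e).

Definition contains_strong_immersion (G H : mgraph) : Prop :=
  exists (thV : vert H -> vert G) (thE : edge H -> subgraph G),
    is_strong_immersion thV thE.

Definition edge_connected_set (k : nat) (G : mgraph) (W : {set vert G}) : Prop :=
  forall u v, u \in W -> v \in W ->
  ~ exists S : {set vert G},
      [/\ u \in S, v \notin S & #|edges_between S (~: S)| < k].

(* The vertices of X are indexed from 0, so pl_ord i is x_(i+1) in the usual
   numbering x_1, ..., x_t, while pl_bag i is B_i for 0 <= i <= t. *)
Record pathlike (G : mgraph) (X : {set vert G}) := Pathlike {
  pl_size : nat;
  pl_ord : 'I_pl_size -> vert G;
  pl_ord_inj : injective pl_ord;
  pl_ord_img : [set pl_ord i | i : 'I_pl_size] = X;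
  pl_bag : 'I_pl_size.+1 -> {set vert G};
  pl_bag_disjoint : forall i j, i != j -> [disjoint pl_bag i & pl_bag j];
  pl_bag_cover : \bigcup_i pl_bag i = ~: X
}.

Section Pathlike.

Variables (G : mgraph) (X : {set vert G}) (P : pathlike X).

Definition pl_left (i : 'I_(pl_size P)) : {set vert G} :=
  [set pl_ord j | j : 'I_(pl_size P) & j < i]
  :|: \bigcup_(j < (pl_size P).+1 | j <= i) pl_bag j.

Definition pl_right (i : 'I_(pl_size P)) : {set vert G} :=
  [set pl_ord j | j : 'I_(pl_size P) & i < j]
  :|: \bigcup_(j < (pl_size P).+1 | i < j) pl_bag j.

Definition pl_cut (i : 'I_(pl_size P)) : {set edge G} :=
  edges_between (pl_left i) (pl_right i).

Definition pl_width : nat := \max_(i < pl_size P) #|pl_cut i|.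

Definition bags_meeting (Z : {set vert G}) : nat :=
  #|[set i | pl_bag (p := P) i :&: Z != set0]|.

Definition pl_bounded (p : nat) (Z : {set vert G}) : Prop :=
  #|X :&: Z| + bags_meeting Z <= p.

End Pathlike.

Definition linear_set (a w p : nat) (G : mgraph) (W : {set vert G}) : Prop :=
  exists A : {set vert G},
    [/\ A \subset W, #|A| <= a &
        exists P : pathlike (trace A W),
          pl_width P < w /\
          forall v, v \in A -> pl_bounded P p (trace A (nbhd v))].

(* Main.v *)
Require Import Defs.
From mathcomp Require Import all_boot zify.

(** Suppose that G contains K_n as a strong immersion, and let W be the set of
    its n branch vertices. The proof counts, for a well-chosen set C of edges
    of G, the edges of K_n whose images must meet C; as the images are
    edge-disjoint, there are at most #|C| of them. On the other hand, K_n has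
    #|X| * #|Y| >= #|X| + #|Y| - 1 edges between two disjoint nonempty sets X
    and Y of vertices ([clique_images_meet_cut]).

    - W is (n-1)-edge-connected: if S separates two branch vertices, take for
      X and Y the two classes of branch vertices that it defines. The image of
      an edge between them is connected, so it contains an edge of the cut
      ([branch_set_edge_connected]). For n > d, the hypothesis therefore makes
      W linear.

    - W is not linear once n > a + w + 1: let A be the exceptional set and x
      the second vertex in the ordering of W \ A. Since A and x consist of
      branch vertices, strongness makes the image of an edge of K_n avoid
      them, except possibly at its own ends. Hence each image that joins a
      branch vertex on the left of x to one on the right of x lives in G - A
      without x and uses an edge of the x-cut. There are at least
      n - a - 2 >= w such images, but fewer than w edges in the x-cut
      ([branch_set_not_linear]). *)

Set Implicit Arguments.
Unset Strict Implicit.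
Unset Printing Implicit Defensive.

(** * Cuts and edge-disjoint connected subgraphs *)

(** Without an edge leaving [L], membership in [L] would be invariant along the
    adjacency relation of the subgraph, hence constant on it. *)
Lemma connected_crosses_cut (G : mgraph) (S : subgraph G) (L : {set vert G}) u v :
  connected_subgraph S -> u \in sub_vert S -> v \in sub_vert S ->
  u \in L -> v \notin L ->
  exists2 g, g \in sub_edge S & g \in edges_between L (~: L).
Proof.
move=> [_ conS] uS vS uL vL; apply/exists_inP; apply: contraNT vL.
move=> /exists_inPn noL.
have clL : closed [rel x y | [exists e in sub_edge S, joins e x y]] (mem L).
  move=> x y /= /exists_inP[g gS gxy].
  move: (noL g gS); rewrite !inE.
  by case/orP: gxy => /andP[/eqP -> /eqP ->]; case: (x \in L); case: (y \in L).
by rewrite -[v \in L](closed_connect clL (conS u v uS vS)).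
Qed.

(** Orienting every edge from [X] to [Y] maps the edges between [X] and [Y]
    onto all pairs in the product of [X] and [Y]. *)
Lemma complete_graph_edges_between n (X Y : {set vert (complete_graph n)}) :
  [disjoint X & Y] -> #|X| * #|Y| <= #|edges_between X Y|.
Proof.
move=> dXY; rewrite -cardsX.
pose orient (e : edge (complete_graph n)) :=
  if src e \in X then (src e, tgt e) else (tgt e, src e).
apply: leq_trans (leq_imset_card orient _).
apply/subset_leq_card/subsetP => -[x y]; rewrite inE /= => /andP[xX yY].
have yX : y \notin X by rewrite (disjointFl dXY).
have [xy | yx | /ord_inj exy] := ltngtP x y; last by rewrite -exy xX in yX.
- pose e : edge (complete_graph n) :=
    exist (fun ij : 'I_n * 'I_n => ij.1 < ij.2) (x, y) xy.
  by apply/imsetP; exists e; rewrite ?inE /orient /= ?xX ?yY.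
- pose e : edge (complete_graph n) :=
    exist (fun ij : 'I_n * 'I_n => ij.1 < ij.2) (y, x) yx.
  by apply/imsetP; exists e; rewrite ?inE /orient /= ?xX ?yY ?orbT // (negPf yX).
Qed.

Lemma disjoint_family_meets (I T : finType) (F : I -> {set T})
    (E : {set I}) (C : {set T}) :
  (forall i j, i != j -> [disjoint F i & F j]) ->
  (forall i, i \in E -> exists2 c, c \in F i & c \in C) ->
  #|E| <= #|C|.
Proof.
move=> dF meetC; have [->|[i0 i0E]] := set_0Vmem E; first by rewrite cards0.
have [c0 _ _] := meetC i0 i0E.
pose rep i := odflt c0 [pick c | (c \in F i) && (c \in C)].
have repP i : i \in E -> (rep i \in F i) && (rep i \in C).
  move=> iE; rewrite /rep; case: pickP => [c //|no].
  by have [c cF cC] := meetC i iE; have := no c; rewrite cF cC.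
have injrep : {in E &, injective rep}.
  move=> i j iE jE eq_rep; apply/eqP; apply: contraT => /dF.
  have /andP[ri _] := repP i iE; have /andP[rj _] := repP j jE.
  by move=> /disjointFr /(_ ri); rewrite eq_rep rj.
rewrite -(card_in_imset injrep); apply: subset_leq_card.
by apply/subsetP => _ /imsetP[i iE ->]; case/andP: (repP i iE).
Qed.

(** * Immersed cliques *)

Section CliqueImmersion.

Variables (n : nat) (G : mgraph).
Variables (thV : vert (complete_graph n) -> vert G).
Variables (thE : edge (complete_graph n) -> subgraph G).
Hypothesis imm : is_immersion thV thE.

(** The product bound is weakened to a sum because only the total size of the
    two classes of branch vertices is known when the lemma is used. *)
Lemma clique_images_meet_cut (X Y : {set vert (complete_graph n)})
    (C : {set edge G}) :
  [disjoint X & Y] -> 0 < #|X| -> 0 < #|Y| ->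
  (forall e, e \in edges_between X Y ->
     exists2 g, g \in sub_edge (thE e) & g \in C) ->
  #|X| + #|Y| <= #|C|.+1.
Proof.
move=> dXY X0 Y0 meetC.
have le1 := disjoint_family_meets (immersion_disjoint imm) meetC.
by have le2 := complete_graph_edges_between dXY; nia.
Qed.

Lemma image_crosses_cut (L R : {set vert G}) e :
  [disjoint L & R] -> e \in edges_between (thV @^-1: L) (thV @^-1: R) ->
  exists2 g, g \in sub_edge (thE e) & g \in edges_between L (~: L).
Proof.
move=> dLR; rewrite !inE.
have sS : thV (src e) \in sub_vert (thE e).
  by apply: (immersion_incident imm); rewrite /incident eqxx.
have tS : thV (tgt e) \in sub_vert (thE e).
  by apply: (immersion_incident imm); rewrite /incident eqxx orbT.
have con := immersion_connected imm e.
case/orP=> /andP[].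
- by move=> sL tR; apply: (connected_crosses_cut con sS tS sL); rewrite (disjointFl dLR).
- by move=> sR tL; apply: (connected_crosses_cut con tS sS tL); rewrite (disjointFl dLR).
Qed.

Lemma branch_set_edge_connected d : d < n -> edge_connected_set d (thV @: setT).
Proof.
move=> ltdn _ _ /imsetP[u _ ->] /imsetP[v _ ->] [S [uS vS ltd]].
have dS : [disjoint S & ~: S] by rewrite -setI_eq0 setICr.
pose X := thV @^-1: S.
have dX : [disjoint X & thV @^-1: ~: S] by rewrite preimsetC -setI_eq0 setICr.
have X0 : 0 < #|X| by apply/card_gt0P; exists u; rewrite inE.
have Y0 : 0 < #|thV @^-1: ~: S| by apply/card_gt0P; exists v; rewrite !inE.
have := clique_images_meet_cut dX X0 Y0 (fun e => @image_crosses_cut _ _ e dS).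
by rewrite preimsetC cardsC card_ord; lia.
Qed.

End CliqueImmersion.

(** * The two sides of a cut in a path-like decomposition *)

Section PathlikeSides.

Variables (G : mgraph) (X : {set vert G}) (P : pathlike X).
Implicit Types i j : 'I_(pl_size P).

Lemma pl_size_card : pl_size P = #|X|.
Proof.
have := congr1 (fun Z : {set vert G} => #|Z|) (pl_ord_img P).
by rewrite card_imset ?card_ord //; apply: pl_ord_inj.
Qed.

Lemma pl_ordP v : reflect (exists i, v = pl_ord i) (v \in X).
Proof.
have /setP/(_ v) eX := pl_ord_img P; rewrite -eX.
by apply: (iffP imsetP) => [[i _ ->]|[i ->]]; exists i.
Qed.

Lemma pl_ord_in i : pl_ord i \in X.
Proof. by apply/pl_ordP; exists i. Qed.

Lemma pl_ord_left i j : j < i -> pl_ord j \in pl_left i.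
Proof. by move=> ji; apply/setUP; left; apply: imset_f; rewrite inE. Qed.

Lemma pl_ord_right i j : i < j -> pl_ord j \in pl_right i.
Proof. by move=> ij; apply/setUP; left; apply: imset_f; rewrite inE. Qed.

Lemma pl_bag_notin k v : v \in pl_bag (p := P) k -> v \notin X.
Proof.
move=> vk; rewrite -in_setC; have /setP/(_ v) cov := pl_bag_cover P; rewrite -cov.
by apply/bigcupP; exists k.
Qed.

Lemma pl_ord_notin_sides i : pl_ord i \notin pl_left i :|: pl_right i.
Proof.
rewrite !inE !negb_or -!andbA; apply/and4P; split; apply/negP.
- by case/imsetP=> j; rewrite inE => + /pl_ord_inj eij; rewrite -eij ltnn.
- by case/bigcupP=> k _ /pl_bag_notin; rewrite pl_ord_in.
- by case/imsetP=> j; rewrite inE => + /pl_ord_inj eij; rewrite -eij ltnn.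
- by case/bigcupP=> k _ /pl_bag_notin; rewrite pl_ord_in.
Qed.

Lemma pl_left_right_disjoint i : [disjoint pl_left i & pl_right i].
Proof.
rewrite disjoint_subset; apply/subsetP => v; rewrite !inE => vl; apply/negP.
case/orP: vl => [/imsetP[j ji ->]|/bigcupP[k ki vk]].
- case/orP=> [/imsetP[j' ij' /pl_ord_inj ejj']|/bigcupP[k _ /pl_bag_notin]].
    by move: ji ij'; rewrite ejj' !inE; lia.
  by rewrite pl_ord_in.
- case/orP=> [/imsetP[j' _ ejj']|/bigcupP[k' ik' vk']].
    by have := pl_bag_notin vk; rewrite ejj' pl_ord_in.
  have /pl_bag_disjoint/disjointFr/(_ vk) : k != k'.
    by apply/eqP => ekk'; move: ki ik'; rewrite ekk'; lia.
  by rewrite vk'.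
Qed.

Lemma pl_sides_cover i v :
  v != pl_ord i -> v \notin pl_left i -> v \in pl_right i.
Proof.
have [/pl_ordP[j ->] nij|] := boolP (v \in X).
- have [ji|ij|/ord_inj eij] := ltngtP j i; last by rewrite eij eqxx in nij.
    by rewrite pl_ord_left.
  by rewrite pl_ord_right.
- rewrite -in_setC; have /setP/(_ v) cov := pl_bag_cover P; rewrite -cov.
  move=> /bigcupP[k _ vk] _ vl.
  rewrite inE; apply/orP; right; apply/bigcupP; exists k => //.
  rewrite ltnNge; apply: contra vl => ki.
  by rewrite inE; apply/orP; right; apply/bigcupP; exists k.
Qed.

End PathlikeSides.

(** * Branch sets of large cliques *)

Lemma card_trace (G : mgraph) (A W : {set vert G}) : #|trace A W| = #|W :\: A|.
Proof.
rewrite -(card_imset _ val_inj); apply: eq_card => v; apply/imsetP/setDP.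
- by case=> x; rewrite inE => xW ->; split=> //; apply: (valP x).
- by case=> vW vA; exists (exist _ v vA); rewrite ?inE.
Qed.

(** The cut at the second vertex is enough: it leaves one vertex of the
    ordering on its left and all but two on its right. *)
Lemma branch_set_not_linear a w p n (G : mgraph)
    (thV : vert (complete_graph n) -> vert G)
    (thE : edge (complete_graph n) -> subgraph G) :
  0 < w -> a + w + 1 < n -> is_strong_immersion thV thE ->
  ~ linear_set a w p (thV @: setT).
Proof.
move=> w0 ltn [imm strong] [A [AW leA [P [ltw _]]]].
set W := thV @: setT in AW P ltw.
have cardW : #|W| = n by rewrite card_imset ?cardsT ?card_ord //; apply: immersion_inj imm.
have size_ge : n - a <= pl_size P.
  by rewrite pl_size_card card_trace cardsD (setIidPr AW) cardW; lia.
have lt0 : 0 < pl_size P by lia.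
have lt1 : 1 < pl_size P by lia.
have lt2 : 2 < pl_size P by lia.
pose i := Ordinal lt1.
pose L := [set val v | v in pl_left i]; pose R := [set val v | v in pl_right i].
have dLR : [disjoint L & R].
  rewrite disjoint_subset; apply/subsetP => _ /imsetP[x xl ->]; rewrite inE.
  apply/imsetP => -[y yr /val_inj exy].
  by have := disjointFr (pl_left_right_disjoint i) xl; rewrite exy yr.
have sideNA (v : vert G) : v \in L :|: R -> (v \notin A) && (v != val (pl_ord i)).
  have nside x : x \in pl_left i :|: pl_right i -> val x != val (pl_ord i).
    by apply: contraTneq => /val_inj ->; apply: pl_ord_notin_sides.
  rewrite inE => /orP[] /imsetP[x xs ->]; rewrite (valP x) nside //.
    by rewrite inE xs.
  by rewrite inE xs orbT.
pose X := thV @^-1: L; pose Y := thV @^-1: R.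
have dXY : [disjoint X & Y].
  by rewrite -setI_eq0 -preimsetI (disjoint_setI0 dLR) preimset0.
have branch (x : vert (delete A)) : x \in trace A W -> exists u, thV u = val x.
  by rewrite inE => /imsetP[u _ ->]; exists u.
have X0 : 0 < #|X|.
  have [u eu] := branch _ (pl_ord_in (Ordinal lt0)).
  by apply/card_gt0P; exists u; rewrite inE eu imset_f ?pl_ord_left.
have Y0 : 0 < #|Y|.
  have [u eu] := branch _ (pl_ord_in (Ordinal lt2)).
  by apply/card_gt0P; exists u; rewrite inE eu imset_f ?pl_ord_right.
(* A branch vertex on neither side lies in A or is the vertex of the cut. *)
have cardXY : n <= #|X| + #|Y| + a + 1.
  have sub : W \subset (thV @: X :|: thV @: Y) :|: (A :|: [set val (pl_ord i)]).
    apply/subsetP => _ /imsetP[u _ ->].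
    have [uA|uA] := boolP (thV u \in A); first by rewrite !inE uA !orbT.
    pose x : vert (delete A) := exist _ (thV u) uA.
    have [exi|nxi] := eqVneq x (pl_ord i); first by rewrite !inE -exi /= eqxx !orbT.
    have [xl|xl] := boolP (x \in pl_left i).
      have uX : u \in X by rewrite inE; apply/imsetP; exists x.
      by rewrite !inE (imset_f thV uX).
    have uY : u \in Y.
      by rewrite inE; apply/imsetP; exists x => //; apply: pl_sides_cover.
    by rewrite !inE (imset_f thV uY) !orbT.
  have := subset_leq_card sub; rewrite cardW.
  have := leq_card_setU (thV @: X :|: thV @: Y) (A :|: [set val (pl_ord i)]).
  have := leq_card_setU (thV @: X) (thV @: Y).
  have := leq_card_setU A [set val (pl_ord i)].
  rewrite cards1 => [[+ _] [+ _] [+ _]].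
  have := leq_imset_card thV X; have := leq_imset_card thV Y.
  lia.
pose C := [set val g | g in pl_cut i].
have meetC e : e \in edges_between X Y -> exists2 g, g \in sub_edge (thE e) & g \in C.
  move=> eXY; have [g gS gL] := image_crosses_cut imm dLR eXY.
  have ends : (thV (src e) \in L :|: R) && (thV (tgt e) \in L :|: R).
    move: eXY; rewrite !inE => /orP[] /andP[-> ->]; rewrite ?orbT //.
  have /andP[/sideNA/andP[sA si] /sideNA/andP[tA ti]] := ends.
  (* Strongness: a branch vertex on the image of e is an end of e. *)
  have avoid z : z \in sub_vert (thE e) -> (z \notin A) && (z != val (pl_ord i)).
    move=> zS; rewrite -negb_or; apply: contraL (zS) => bad.
    have [v ev] : exists v, thV v = z.
      case/orP: bad => [/(subsetP AW)/imsetP[v _ ->]|/eqP ->]; first by exists v.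
      exact/branch/pl_ord_in.
    rewrite -ev; apply: strong; apply/negP => /orP[] /eqP evs.
      by move: bad; rewrite -ev evs (negPf sA) (negPf si).
    by move: bad; rewrite -ev evs (negPf tA) (negPf ti).
  have /andP[gs gt] := sub_ends gS.
  have /andP[gsA gsi] := avoid _ gs; have /andP[gtA gti] := avoid _ gt.
  have gP : (src g \notin A) && (tgt g \notin A) by rewrite gsA gtA.
  pose g' : edge (delete A) := exist _ g gP.
  exists g => //; apply/imsetP; exists g' => //.
  have inL (x : vert (delete A)) : (val x \in L) = (x \in pl_left i).
    by rewrite mem_imset //; apply: val_inj.
  have notL (x : vert (delete A)) :
      val x != val (pl_ord i) -> val x \notin L -> x \in pl_right i.
    by rewrite inL => nxi; apply: pl_sides_cover; apply: contraNneq nxi => ->.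
  move: gL; rewrite [in X in X -> _]inE => ends_g.
  rewrite inE; case/orP: ends_g => /andP[]; rewrite !in_setC => g1 g2.
    have sl : src g' \in pl_left i by rewrite -inL.
    by rewrite sl (notL (tgt g') gti g2).
  have tl : tgt g' \in pl_left i by rewrite -inL.
  by rewrite tl (notL (src g') gsi g1) orbT.
have leC : #|C| < w.
  apply: leq_ltn_trans ltw; apply: leq_trans (leq_imset_card _ _) _.
  exact: (leq_bigmax (F := fun j => #|pl_cut j|)).
have := clique_images_meet_cut imm dXY X0 Y0 meetC.
lia.
Qed.

Theorem theorem10 (d a w p : nat)
    (hd : 1 <= d) (ha : 1 <= a) (hw : 1 <= w) (hp : 1 <= p) :
  exists n : nat, forall G : mgraph,
    (forall W : {set vert G}, edge_connected_set d W -> linear_set a w p W) ->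
    ~ contains_strong_immersion G (complete_graph n).
Proof.
exists (a + w + d).+1 => G lin [thV [thE sth]].
have conn : edge_connected_set d (thV @: setT).
  by apply: (branch_set_edge_connected (proj1 sth)); lia.
by apply: (branch_set_not_linear _ _ sth (lin _ conn)); lia.
Qed.
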